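(* There exists a sequence of Boolean functions $\{f_n\}_{n\ge1}$, $f_n:\{0,1\}^{m_n}\to\{0,1\}$, which is nondegenerate with respect to $\{p_n\}\equiv1/2$, satisfies $\lim_{n\to\infty}\mathbb{E}[C_n]=\infty$, but is tame (with respect to $\{p_n\}\equiv 1/2$).
   Context: For each $n$, $X^{(n)}(t)=(X^{(n)}_1(t),\dots,X^{(n)}_{m_n}(t))$, $t\ge0$, where the coordinates are independent stationary continuous-time Markov chains on $\{0,1\}$ jumping from $0$ to $1$ at rate $p_n$ and from $1$ to $0$ at rate $1-p_n$ (so each is $1$ with probability $p_n$ at any fixed time). $C_n$ is the number of times $f_n(X^{(n)}(t))$ changes state during $[0,1]$. The sequence is nondegenerate with respect to $\{p_n\}$ if there is $\delta>0$ with $\mathbb{P}(f_n(X^{(n)}(0))=1)\in[\delta,1-\delta]$ for all $n$. It is tame with respect to $\{p_n\}$ if $\{C_n\}_{n\ge1}$ is tight. *)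

(* Defs.v *)
From HB Require Import structures.
From mathcomp Require Import all_boot all_order all_algebra.
From mathcomp Require Import all_classical all_reals all_analysis.
Set Implicit Arguments.
Unset Strict Implicit.
Unset Printing Implicit Defensive.
Import Order.TTheory GRing.Theory Num.Theory.
Import numFieldNormedType.Exports.
Local Open Scope classical_set_scope.
Local Open Scope ring_scope.

(* A process [Y : R -> T -> S] is indexed by all of [R]; only its values at
   times [t >= 0] are ever constrained or used.  State 1 is [true]. *)

(* The event [Y (t 0) = x 0, ..., Y (t k.-1) = x k.-1]. *)
Definition fdd_event (R : realType) (T S : Type) (Y : R -> T -> S)
    (k : nat) (t : nat -> R) (x : nat -> S) : set T :=
  [set w | forall i, (i < k)%N -> Y (t i) w = x i].

(* [K h i j] is the probability to go from [i] to [j] in time [h]. *)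
Record transition_function (R : realType) (K : R -> bool -> bool -> R) : Prop := {
  tf_ge0 : forall (h : R) i j, 0 <= h -> 0 <= K h i j ;
  tf_sum1 : forall (h : R) i, 0 <= h -> \sum_(j : bool) K h i j = 1 ;
  tf_id : forall i j, K 0 i j = (i == j)%:R ;
  tf_semigroup : forall (s h : R) i j, 0 <= s -> 0 <= h ->
    K (s + h) i j = \sum_(l : bool) K s i l * K h l j }.

(* The jump rates are the right derivatives at time 0 of the off-diagonal
   entries, that is, the off-diagonal entries of the generator. *)
Definition has_jump_rates (R : realType) (K : R -> bool -> bool -> R)
    (rate01 rate10 : R) : Prop :=
  (h^-1 * K h false true @[h --> 0^'+] --> rate01) /\
  (h^-1 * K h true false @[h --> 0^'+] --> rate10).

Definition markov_with (d : measure_display) (T : measurableType d)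
    (R : realType) (P : probability T R) (K : R -> bool -> bool -> R)
    (Y : R -> T -> bool) : Prop :=
  forall (k : nat) (t : nat -> R) (x : nat -> bool),
    0 <= t 0%N -> (forall i, (i <= k)%N -> t i < t i.+1) ->
    P (fdd_event Y k.+2 t x) =
      (P (fdd_event Y k.+1 t x) * (K (t k.+1 - t k) (x k) (x k.+1))%:E)%E.

Definition stationary (d : measure_display) (T : measurableType d)
    (R : realType) (P : probability T R) (Y : R -> T -> bool) : Prop :=
  forall (h : R) (k : nat) (t : nat -> R) (x : nat -> bool),
    0 <= h -> (forall i, 0 <= t i) ->
    P (fdd_event Y k (fun i => t i + h) x) = P (fdd_event Y k t x).

(* Right-continuous paths with left limits for the discrete topology; such a
   path has finitely many jumps in every bounded time interval. *)
Definition cadlag (R : realType) (S : Type) (g : R -> S) : Prop :=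
  (forall t : R, 0 <= t -> \forall s \near t^'+, g s = g t) /\
  (forall t : R, 0 < t -> exists a : S, \forall s \near t^'-, g s = a).

Record stationary_chain (d : measure_display) (T : measurableType d)
    (R : realType) (P : probability T R) (rate01 rate10 : R)
    (Y : R -> T -> bool) : Prop := {
  chain_measurable : forall t : R, 0 <= t -> measurable_fun setT (Y t) ;
  chain_cadlag : forall w, cadlag (Y ^~ w) ;
  chain_markov : exists K, [/\ transition_function K,
    has_jump_rates K rate01 rate10 & markov_with P K Y] ;
  chain_stationary : stationary P Y }.

Definition sigma_process (R : realType) (T : Type) (Y : R -> T -> bool) :
    set (set T) :=
  <<s [set A | exists t : R, 0 <= t /\ exists B : set bool, A = Y t @^-1` B] >>.

(* The factors [A i] may be the whole space, so the product rule over the full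
   family contains the one over every subfamily. *)
Definition independent_processes (d : measure_display) (T : measurableType d)
    (R : realType) (P : probability T R) (m : nat)
    (Y : 'I_m -> R -> T -> bool) : Prop :=
  forall A : 'I_m -> set T, (forall i, sigma_process (Y i) (A i)) ->
    P (\bigcap_(i in [set: 'I_m]) A i) = (\prod_(i < m) P (A i))%E.

Definition cube_dynamics (d : measure_display) (T : measurableType d)
    (R : realType) (P : probability T R) (p : R) (m : nat)
    (X : R -> T -> {ffun 'I_m -> bool}) : Prop :=
  (forall i, stationary_chain P p (1 - p) (fun t w => X t w i)) /\
  independent_processes P (fun i t w => X t w i).

(* Number, possibly [+oo], of jump times in [0, 1] of a right-continuous path:
   the times at which the path differs from its left limit. *)
Definition num_changes (R : realType) (g : R -> bool) : \bar R :=
  counting [set t : R | 0 < t <= 1 /\ ~ \forall s \near t^'-, g s = g t].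

Definition changes (R : realType) (T : Type) (m : nat)
    (f : {ffun 'I_m -> bool} -> bool) (X : R -> T -> {ffun 'I_m -> bool})
    (w : T) : \bar R :=
  num_changes (fun t => f (X t w)).

Definition nondegenerate_sequence (R : realType) (m : nat -> nat)
    (f : forall n, {ffun 'I_(m n) -> bool} -> bool)
    (d : nat -> measure_display) (T : forall n, measurableType (d n))
    (P : forall n, probability (T n) R)
    (X : forall n, R -> T n -> {ffun 'I_(m n) -> bool}) : Prop :=
  exists delta : R, 0 < delta /\ forall n,
    (delta%:E <= P n [set w | f n (X n 0%R w) = true] <= (1 - delta)%:E)%E.

Definition tight (R : realType) (d : nat -> measure_display)
    (T : forall n, measurableType (d n)) (P : forall n, probability (T n) R)
    (C : forall n, T n -> \bar R) : Prop :=
  forall eps : R, 0 < eps -> exists M : R, forall n,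
    (P n [set w | M%:E < C n w] <= eps%:E)%E.

Definition tame_sequence (R : realType) (m : nat -> nat)
    (f : forall n, {ffun 'I_(m n) -> bool} -> bool)
    (d : nat -> measure_display) (T : forall n, measurableType (d n))
    (P : forall n, probability (T n) R)
    (X : forall n, R -> T n -> {ffun 'I_(m n) -> bool}) : Prop :=
  tight P (fun n => changes (f n) (X n)).

(* Main.v *)
Require Import Defs.
From mathcomp Require Import all_boot all_order all_algebra.
From mathcomp Require Import all_classical all_reals all_analysis.
From mathcomp Require Import measurable_realfun finmap zify ring lra.
Set Implicit Arguments.
Unset Strict Implicit.
Unset Printing Implicit Defensive.
Import Order.TTheory GRing.Theory Num.Theory.
Import numFieldNormedType.Exports.
Local Open Scope classical_set_scope.
Local Open Scope ring_scope.

(* Let [f x] be the coordinate [x i0], except when all the coordinates in a set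
   [S] of size [k] are 1, in which case [f x] is the parity of all the [m]
   coordinates.  The exceptional event has probability [2^-k] at a fixed time
   and is seen at all during [0, 1] with probability at most [(k + 1) 2^-k]:
   each entrance needs one of [k] coordinates to flip.  Outside it [f] changes
   as often as one coordinate, which gives nondegeneracy and tightness.  But
   with at least [L = 8^k] coordinates outside [S], the parity flips with
   probability bounded below in a time [1 / L], so that the expected number of
   changes is at least of order [8^k 4^-k].

   All estimates are made on the grid [j / L]: a path has at least as many
   jumps as its samples have changes, and any finite set of jumps is detected
   by all fine enough grids. *)

(** * Jumps of a path and changes on a grid *)

Section Paths.
Variable R : realType.
Implicit Types (g : R -> bool) (L : nat).

Definition grid_changes g L : nat :=
  (\sum_(j < L) (g (j%:R / L%:R) != g (j.+1%:R / L%:R)))%N.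

Definition jumps g : set R :=
  [set t | 0 < t <= 1 /\ ~ \forall s \near t^'-, g s = g t].

Lemma near_rightP (Q : R -> Prop) (u : R) :
  (\forall s \near u^'+, Q s) <->
  exists e : R, 0 < e /\ forall s, u < s < u + e -> Q s.
Proof.
split.
  move=> /nbhs_ballP[e /= e0 He]; exists e; split=> // s /andP[us se].
  by apply: He => //; rewrite /ball /= ltr_norml; apply/andP; split; lra.
move=> [e [e0 He]]; apply/nbhs_ballP; exists e => //= s.
rewrite /ball /= ltr_norml => /andP[h1 h2] us; apply: He.
by apply/andP; split; lra.
Qed.

Lemma near_leftP (Q : R -> Prop) (u : R) :
  (\forall s \near u^'-, Q s) <->
  exists e : R, 0 < e /\ forall s, u - e < s < u -> Q s.
Proof.
split.
  move=> /nbhs_ballP[e /= e0 He]; exists e; split=> // s /andP[us se].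
  by apply: He => //; rewrite /ball /= ltr_norml; apply/andP; split; lra.
move=> [e [e0 He]]; apply/nbhs_ballP; exists e => //= s.
rewrite /ball /= ltr_norml => /andP[h1 h2] us; apply: He.
by apply/andP; split; lra.
Qed.

(* The jump is the first time after [a] at which the path leaves [g a]. *)
Lemma jump_between g (a b : R) : cadlag g -> 0 <= a -> a < b -> g a != g b ->
  exists u, a < u <= b /\ ~ \forall s \near u^'-, g s = g u.
Proof.
move=> [rc _] a0 ab gab.
pose V := [set v | a < v <= b /\ g v != g a].
have Vb : V b by split; [rewrite ab lexx | rewrite eq_sym].
have Vinf : has_inf V.
  by split; [exists b | exists a => v [/andP[/ltW]]].
have Vlb v : V v -> inf V <= v by move=> Vv; apply: ge_inf => //; case: Vinf.
have aV : a <= inf V by apply: lb_le_inf; [exists b | move=> v [/andP[/ltW]]].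
have before s : a <= s -> s < inf V -> g s = g a.
  move=> as_ sV; have [->//|nsa] := eqVneq s a.
  apply/eqP; apply: contraT => gs.
  have : V s by split => //; rewrite lt_neqAle eq_sym nsa as_ (le_trans (ltW sV))// Vlb.
  by move/Vlb; rewrite leNgt sV.
have gV : g (inf V) != g a.
  apply/negP => /eqP gV.
  have /near_rightP[e [e0 He]] := rc (inf V) (le_trans a0 aV).
  have [v Vv vlt] := inf_adherent e0 Vinf.
  have [_ /eqP] := Vv; apply.
  have := Vlb _ Vv; rewrite le_eqVlt => /predU1P[<-//|Vltv].
  by rewrite He ?gV// Vltv.
exists (inf V); split.
  rewrite Vlb// andbT lt_neqAle aV andbT; apply: contraNneq gV => <-; exact: eqxx.
have aV' : a < inf V.
  by rewrite lt_neqAle aV andbT; apply: contraNneq gV => <-; exact: eqxx.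
move=> /near_leftP[e [e0 He]].
pose s := Num.max a (inf V - e / 2).
have sV : s < inf V by rewrite /s gt_max aV' /=; lra.
have sl : inf V - e < s by rewrite /s lt_max; apply/orP; right; lra.
move/eqP: gV; apply; rewrite -(He s) ?sl//.
by apply: before => //; rewrite /s le_max lexx.
Qed.

Lemma num_changes_ge g (r : seq R) : uniq r -> (forall t, t \in r -> jumps g t) ->
  ((size r)%:R%:E <= num_changes g)%E.
Proof.
move=> ur rJ; rewrite /num_changes -/(jumps g) /counting.
case: asboolP => [fJ|_]; last by rewrite leey.
rewrite lee_fin ler_nat -(@undup_id _ r)//.
rewrite -card_fseq; apply: fsubset_leq_card; apply/fsubsetP => t.
by rewrite in_fset => /rJ Jt; rewrite in_fset_set//; apply/mem_set.
Qed.

Lemma grid_changes_le g L : cadlag g ->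
  ((grid_changes g L)%:R%:E <= num_changes g)%E.
Proof.
move=> cg.
pose F := [seq j : 'I_L <- enum 'I_L | g (j%:R / L%:R) != g (j.+1%:R / L%:R)].
have FE : grid_changes g L = size F.
  by rewrite /grid_changes size_filter -sum1_count [RHS]big_mkcond big_enum /=.
have Hj (j : 'I_L) : exists u : R, g (j%:R / L%:R) != g (j.+1%:R / L%:R) ->
    j%:R / L%:R < u <= j.+1%:R / L%:R /\ jumps g u.
  have L0 : 0 < L%:R :> R by rewrite ltr0n; case: L j {F FE} => // -[].
  case: (boolP (g (j%:R / L%:R) != _)) => [gj|_]; last by exists 0.
  have := @jump_between g (j%:R / L%:R) (j.+1%:R / L%:R) cg _ _ gj.
  case=> [||u [/andP[u1 u2] Ju]].
  - by rewrite divr_ge0.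
  - by rewrite ltr_pM2r ?invr_gt0// ltr_nat.
  exists u => _; split; first by rewrite u1.
  split => //; rewrite (le_lt_trans _ u1) ?divr_ge0//=.
  by rewrite (le_trans u2)// ler_pdivrMr// mul1r ler_nat.
have [u Hu] := choice Hj.
rewrite FE -(size_map u); apply: num_changes_ge.
  rewrite map_inj_in_uniq; first by rewrite filter_uniq; last exact: enum_uniq.
  suff lt_u (i j : 'I_L) : i \in F -> j \in F -> (i < j)%N -> u i < u j.
    move=> i j iF jF uij; apply/val_inj/eqP.
    have [ij|ij|//] := ltngtP (val i) (val j).
      by have := lt_u _ _ iF jF ij; rewrite uij ltxx.
    by have := lt_u _ _ jF iF ij; rewrite uij ltxx.
  rewrite !mem_filter => /andP[/Hu[/andP[_ ui] _] _] /andP[/Hu[/andP[uj _] _] _] ij.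
  apply: le_lt_trans ui _; apply: le_lt_trans uj.
  by rewrite ler_wpM2r ?invr_ge0// ler_nat.
by move=> t /mapP[j]; rewrite mem_filter => /andP[/Hu[_ Ju] _] ->.
Qed.

Lemma jumps_le_grid g (r : seq R) : cadlag g -> uniq r ->
  (forall t, t \in r -> jumps g t) ->
  exists K : nat, forall L, (K <= L)%N -> (size r <= grid_changes g L)%N.
Proof.
move=> [rc lc] ur rJ.
have Hloc t : exists e : R, 0 < e /\ (t \in r -> (forall s, t <= s < t + e -> g s = g t) /\
     (forall s, t - e < s < t -> g s != g t)).
  case: (boolP (t \in r)) => [tr|_]; last by exists 1.
  have [/andP[t0 t1] nJ] := rJ _ tr.
  have /near_rightP[e1 [e10 He1]] := rc _ (ltW t0).
  have [a /near_leftP[e2 [e20 He2]]] := lc _ t0.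
  exists (Num.min e1 e2); split; first by rewrite lt_min e10.
  move=> _; split=> s /andP[s1 s2].
    move: s1; rewrite le_eqVlt => /predU1P[->//|s1]; apply: He1.
    by rewrite s1 (lt_le_trans s2)// lerD2l ge_min lexx.
  have m2 : Num.min e1 e2 <= e2 by rewrite ge_min lexx orbT.
  rewrite (He2 s); last by rewrite s2 andbT; lra.
  apply/negP => /eqP ga; apply: nJ; apply/near_leftP; exists e2; split=> // v Hv.
  by rewrite (He2 v).
have [e He] := choice Hloc.
have [e0 [e00 e0e]] : exists e0, 0 < e0 /\ forall t, t \in r -> e0 <= e t.
  elim: (r) => [|t r' [e' [e'0 He']]]; first by exists 1.
  exists (Num.min (e t) e'); split; first by rewrite lt_min e'0 (He t).1.
  move=> s; rewrite inE => /predU1P[->|/He' se]; first by rewrite ge_min lexx.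
  by rewrite ge_min se orbT.
exists (Num.truncn e0^-1).+1 => L KL.
have L0 : 0 < L%:R :> R by rewrite ltr0n (leq_trans _ KL).
have Le : L%:R^-1 < e0.
  rewrite -[e0]invrK ltf_pV2 ?posrE ?invr_gt0//.
  by rewrite (lt_le_trans (truncnS_gt _))// ler_nat.
have Hj t : exists j : 'I_L.+1, t \in r -> (j < L)%N /\ j%:R / L%:R < t <= j.+1%:R / L%:R.
  case: (boolP (t \in r)) => [tr|_]; last by exists ord0.
  have [/andP[t0 t1] _] := rJ _ tr.
  pose P j := t <= j.+1%:R / L%:R.
  have exP : exists j, P j.
    exists L.-1; rewrite /P prednK ?divff ?gt_eqF//.
    by rewrite -(ltr0n R).
  pose j := ex_minn exP.
  have jL : (j < L)%N.
    rewrite /j; case: ex_minnP => i _ /(_ L.-1).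
    rewrite /P prednK ?divff ?gt_eqF// -?(ltr0n R)// => /(_ t1).
    by rewrite -ltnS prednK// -(ltr0n R).
  exists (inord j) => _; rewrite inordK; last by rewrite ltnS ltnW.
  split=> //.
  rewrite /j; case: ex_minnP => i Pi imin; apply/andP; split=> //.
  rewrite ltNge; apply/negP; case: i imin {Pi} => [|i] imin.
    by rewrite mul0r leNgt t0.
  by move=> /imin; rewrite ltnn.
have [j Hj'] := choice Hj.
pose F := [seq k <- iota 0 L | g (k%:R / L%:R) != g (k.+1%:R / L%:R)].
have FE : grid_changes g L = size F.
  rewrite /grid_changes size_filter -sum1_count [RHS]big_mkcond /=.
  by rewrite -[L in iota 0 L]subn0 big_mkord; apply: eq_bigr => i _; case: (g _ != g _).
rewrite FE -(size_map (fun t => val (j t))); apply: uniq_leq_size.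
  rewrite map_inj_in_uniq//.
  suff Hlt x y : x \in r -> y \in r -> val (j x) = val (j y) -> x < y -> False.
    move=> x y xr yr jxy; have [xy|xy|//] := ltgtP x y.
      by case: (Hlt x y).
    by case: (Hlt y x).
  move=> xr yr jxy xy.
  have [_ /andP[h1 h2]] := Hj' _ xr; have [_ /andP[h3 h4]] := Hj' _ yr.
  move: h1 h2; rewrite jxy => h1 h2.
  have d : (j y).+1%:R / L%:R = (j y)%:R / L%:R + L%:R^-1 :> R.
    by rewrite -natr1 mulrDl mul1r.
  have [_ /(_ xr)[cx _]] := He x; have [_ /(_ yr)[_ ly]] := He y.
  have := e0e _ xr; have := e0e _ yr => ey ex.
  have : g x != g y by apply: ly; apply/andP; split; lra.
  by rewrite (cx y) ?eqxx//; apply/andP; split; lra.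
move=> k /mapP[t tr ->]; rewrite mem_filter mem_iota /= add0n.
have [-> /andP[h1 h2]] := Hj' _ tr; rewrite andbT.
have d : (j t).+1%:R / L%:R = (j t)%:R / L%:R + L%:R^-1 :> R.
  by rewrite -natr1 mulrDl mul1r.
have et := e0e _ tr; have [_ /(_ tr)[ct lt_]] := He t.
rewrite (ct (_.+1%:R / _)); last by apply/andP; split; lra.
by apply: lt_; apply/andP; split; lra.
Qed.

Lemma num_changes_gtP g (M : R) : cadlag g ->
  (M%:E < num_changes g)%E <->
  exists K : nat, forall L, (K <= L)%N -> M < (grid_changes g L)%:R.
Proof.
move=> cg; split; last first.
  move=> [K /(_ K (leqnn _)) HK].
  by apply: lt_le_trans (grid_changes_le K cg); rewrite lte_fin.
move=> MC.
suff [r [ur rJ Mr]] : exists r : seq R,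
    [/\ uniq r, forall t, t \in r -> jumps g t & M < (size r)%:R].
  have [K HK] := jumps_le_grid cg ur rJ.
  by exists K => L /HK; rewrite -(ler_nat R); apply: lt_le_trans.
move: MC; rewrite /num_changes -/(jumps g) /counting.
case: asboolP => [fJ|iJ _].
  rewrite lte_fin => MJ; exists (fset_set (jumps g)); split=> //; first exact: fset_uniq.
  by move=> t; rewrite in_fset_set// => /set_mem.
have [C CJ sC] := infinite_set_fset (Num.truncn M).+1 iJ.
exists C; split; [exact: fset_uniq | by move=> t tC; exact: CJ | ].
by rewrite (lt_le_trans (truncnS_gt _))// ler_nat.
Qed.

End Paths.

(** * The stationary two-state chain *)

Section Chain.
Variable R : realType.

Lemma bernoulli_ineq (x : R) n : -1 <= x -> 1 + n%:R * x <= (1 + x) ^+ n.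
Proof.
move=> x1; elim: n => [|n IH]; first by rewrite mul0r addr0 expr0.
have x2 : 0 <= 1 + x by lra.
rewrite exprSr; apply: le_trans (ler_wpM2r x2 IH).
have : 0 <= n%:R * x ^+ 2 :> R by rewrite mulr_ge0// sqr_ge0.
by rewrite -natr1; lra.
Qed.

Lemma flip_bounds (q : R -> R) :
  (forall h, 0 < h -> 0 <= q h) ->
  (forall s h, 0 < s -> 0 < h -> q (s + h) = q s + q h - 2 * q s * q h) ->
  h^-1 * q h @[h --> 0^'+] --> (2^-1 : R) ->
  forall h, 0 < h ->
    [/\ 0 <= q h, q h <= h, q h <= 2^-1 & 1 - 2 * q h <= (1 + h / 2)^-1].
Proof.
move=> q0 qD qlim h h0.
have [d [d0 Hd]] : exists d : R, 0 < d /\ forall u, 0 < u < d -> u / 4 <= q u <= u.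
  have e0 : (0 : R) < 4^-1 by lra.
  move/cvgrPdist_le: qlim => /(_ _ e0) /nbhs_ballP[d /= d0 Hd].
  exists d; split=> // u /andP[u0 ud].
  have /Hd/(_ u0) : ball 0 d u by rewrite /ball /= sub0r normrN gtr0_norm.
  rewrite ler_norml => /andP[h1 h2].
  have qE : q u = u * (u^-1 * q u) by rewrite mulrA divff ?mul1r ?gt_eqF.
  by rewrite qE; apply/andP; split; nra.
have le_half u : 0 < u -> q u <= 2^-1.
  move=> u0; have u2 : 0 < u / 2 by lra.
  have -> : u = u / 2 + u / 2 by lra.
  by rewrite qD//; have := sqr_ge0 (1 - 2 * q (u / 2)); lra.
have qn u n : 0 < u -> q (n.+1%:R * u) <= n.+1%:R * q u /\
    1 - 2 * q (n.+1%:R * u) = (1 - 2 * q u) ^+ n.+1.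
  move=> u0; elim: n => [|n [IH1 IH2]]; first by rewrite !mul1r expr1.
  have E : n.+2%:R * u = n.+1%:R * u + u by rewrite -natr1 mulrDl mul1r.
  have nu : 0 < n.+1%:R * u by rewrite mulr_gt0.
  rewrite E qD//; split.
    rewrite -[n.+2%:R]natr1 mulrDl mul1r.
    by have := mulr_ge0 (q0 _ nu) (q0 _ u0); lra.
  by rewrite exprSr -IH2; ring.
pose n := Num.truncn (h / d).
pose u := h / n.+1%:R.
have u0 : 0 < u by rewrite divr_gt0.
have ud : u < d.
  rewrite ltr_pdivrMr// mulrC -ltr_pdivrMr//; exact: truncnS_gt.
have hE : h = n.+1%:R * u by rewrite mulrC divfK.
have /andP[u4 qu] : u / 4 <= q u <= u by apply: Hd; rewrite u0.
have [le1 eq1] := qn u n u0.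
split; [exact: q0 | | exact: le_half | ].
  by rewrite hE (le_trans le1)// ler_wpM2l.
rewrite {1}hE eq1.
(* Bernoulli twice: (1 - u/2)^N (1 + N u/2) <= ((1 - u/2)(1 + u/2))^N <= 1. *)
have r0 : 0 <= 1 - 2 * q u by have := le_half _ u0; lra.
have hu : 0 < 1 + h / 2 by lra.
rewrite -[leRHS]mul1r ler_pdivlMr//.
have -> : 1 + h / 2 = 1 + n.+1%:R * (u / 2) by rewrite mulrA -hE.
apply: le_trans (ler_wpM2l _ (bernoulli_ineq _ _)) _; [exact: exprn_ge0 | lra | ].
rewrite -exprMn exprn_ile1//; first by rewrite mulr_ge0//; lra.
by nra.
Qed.

Context d (T : measurableType d) (P : probability T R) (Y : R -> T -> bool).

Lemma chain_pair_law : stationary_chain P 2^-1 (1 - 2^-1) Y ->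
  exists q : R -> R,
    [/\ forall h, 0 < h ->
          [/\ 0 <= q h, q h <= h, q h <= 2^-1 & 1 - 2 * q h <= (1 + h / 2)^-1],
        forall s h x y, 0 <= s -> 0 < h ->
          P [set w | Y s w = x /\ Y (s + h) w = y] =
            (2^-1 * (if x == y then 1 - q h else q h))%:E
      & forall s x, 0 <= s -> P [set w | Y s w = x] = (2^-1)%:E].
Proof.
case=> mY _ [K [[K0 K1 Kid KD] [r01 r10] mk]] st.
have mE s x : 0 <= s -> measurable [set w | Y s w = x].
  by move=> s0; have := mY s s0 measurableT [set x]; rewrite setTI; apply.
pose p x := fine (P [set w | Y 0 w = x]).
have pE s x : 0 <= s -> P [set w | Y s w = x] = (p x)%:E.
  move=> s0; rewrite fineK ?fin_num_measure//; last exact: mE.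
  have := st s 1%N (fun=> 0) (fun=> x) s0 (fun=> lexx 0).
  have -> : fdd_event Y 1 (fun=> 0 + s) (fun=> x) = [set w | Y s w = x].
    by apply/seteqP; split=> w /=; rewrite add0r => H; [exact: (H 0%N)|case].
  move=> ->; congr (P _).
  by apply/seteqP; split=> w /=; [move=> H; exact: (H 0%N)| move=> H; case].
have jE s h x y : 0 <= s -> 0 < h ->
    P [set w | Y s w = x /\ Y (s + h) w = y] = (p x * K h x y)%:E.
  move=> s0 h0.
  have := mk 0%N (fun i => s + i%:R * h) (fun i => if i is 0%N then x else y).
  rewrite mul0r addr0 mul1r; have -> : s + h - s = h by ring.
  have -> : fdd_event Y 2 (fun i => s + i%:R * h)
     (fun i => if i is 0%N then x else y) = [set w | Y s w = x /\ Y (s + h) w = y].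
    apply/seteqP; split=> w /=.
      by move=> H; have := H 0%N isT; have := H 1%N isT; rewrite mul1r mul0r addr0.
    by move=> [H1 H2] [|[|//]] _; rewrite ?mul1r ?mul0r ?addr0.
  have -> : fdd_event Y 1 (fun i => s + i%:R * h)
     (fun i => if i is 0%N then x else y) = [set w | Y s w = x].
    apply/seteqP; split=> w /=.
      by move=> H; have := H 0%N isT; rewrite mul0r addr0.
    by move=> H [|//] _; rewrite mul0r addr0.
  rewrite pE// -EFinM; apply=> // i _.
  by rewrite ltrD2l ltr_pM2r// ltr_nat.
have sum2 (F : bool -> R) : \sum_(b : bool) F b = F true + F false.
  by rewrite big_bool.
have p1 : p true + p false = 1.
  apply: EFin_inj; rewrite EFinD -!(pE 0)// -measureU; [|exact: mE|exact: mE|].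
    rewrite -[RHS](@probability_setT _ _ _ P); congr (P _).
    by apply/seteqP; split=> w //= _; case: (Y 0 w); [left|right].
  by apply/seteqP; split=> w //= [->].
have marg h y : 0 < h -> p y = p true * K h true y + p false * K h false y.
  move=> h0; apply: EFin_inj; rewrite EFinD -(pE h) ?ltW//.
  have jm x : measurable [set w | Y 0 w = x /\ Y (0 + h) w = y].
    by apply: measurableI; apply: mE; rewrite ?add0r// ltW.
  rewrite -!(jE 0)// -measureU//.
    congr (P _); apply/seteqP; split=> w /=; rewrite add0r.
      by move=> ->; case: (Y 0 w); [left|right].
    by case=> -[].
  by apply/seteqP; split=> w //= [[-> _]] [].
have bal h : 0 < h -> p false * K h false true = p true * K h true false.
  move=> h0; have := marg h true h0; have := K1 h true (ltW h0).
  rewrite sum2 => e1 e2.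
  have e3 : K h true true = 1 - K h true false by rewrite -e1; ring.
  by rewrite e3 in e2; lra.
have pp : p false = p true.
  have l1 : h^-1 * (p false * K h false true) @[h --> 0^'+] --> p false * 2^-1.
    under eq_fun do rewrite mulrCA.
    apply: cvgM => //; exact: cvg_cst.
  have l2 : h^-1 * (p false * K h false true) @[h --> 0^'+] --> p true * (1 - 2^-1).
    have : h^-1 * (p true * K h true false) @[h --> 0^'+] --> p true * (1 - 2^-1).
      under eq_fun do rewrite mulrCA.
      apply: cvgM => //; exact: cvg_cst.
    apply: cvg_trans; apply: near_eq_cvg; near=> h.
    by rewrite bal.
  have : p false * 2^-1 = p true * (1 - 2^-1) :> R.
    by apply: cvg_unique l1 l2; exact: Rhausdorff.
  lra.
have pt : p true = 2^-1 by lra.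
have pf : p false = 2^-1 by lra.
have sym h : 0 < h -> K h true false = K h false true.
  by move=> /bal; rewrite pt pf; lra.
exists (fun h => K h false true); split.
- apply: flip_bounds => //; first by move=> h /ltW h0; exact: K0.
  move=> s h s0 h0; rewrite KD ?ltW// sum2.
  have := K1 h true (ltW h0); have := K1 s false (ltW s0); rewrite !sum2 sym//.
  move=> e1 e2; have -> : K h true true = 1 - K h false true by lra.
  have -> : K s false false = 1 - K s false true by lra.
  by ring.
- move=> s h x y s0 h0; rewrite jE//; congr (_%:E).
  have := K1 h x (ltW h0); rewrite sum2.
  have := sym h h0.
  by case: x; case: y => /= e1 e2; rewrite ?pt ?pf; congr (_ * _); lra.
- by move=> s x s0; rewrite pE//; case: x; rewrite ?pt ?pf.
Unshelve. all: by end_near. Qed.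

End Chain.

(** * Events with finitely many outcomes *)

Section Prob.
Context (R : realType) d (T : measurableType d) (P : probability T R).
Implicit Types (A B : set T) (M : R).

Definition prob A : R := fine (P A).

Lemma prE A : measurable A -> P A = (prob A)%:E.
Proof. by move=> mA; rewrite fineK// fin_num_measure. Qed.

Lemma pr_le A B : measurable A -> measurable B -> A `<=` B -> prob A <= prob B.
Proof.
move=> mA mB AB; rewrite -lee_fin -!prE//.
by apply: le_measure => //; exact/mem_set.
Qed.

Lemma pr_setT : prob setT = 1.
Proof. by rewrite /prob probability_setT. Qed.

Lemma prU A B : measurable A -> measurable B -> A `&` B = set0 ->
  prob (A `|` B) = prob A + prob B.
Proof.
move=> mA mB AB; apply: EFin_inj.
by rewrite EFinD -!prE//; [exact: measureU | exact: measurableU].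
Qed.

Lemma prU_le A B : measurable A -> measurable B ->
  prob (A `|` B) <= prob A + prob B.
Proof.
move=> mA mB; rewrite -lee_fin EFinD -!prE//; last exact: measurableU.
exact: measureU2.
Qed.

Lemma measurable_has (I : Type) (r : seq I) (F : I -> T -> bool) :
  (forall i, measurable [set w | F i w]) ->
  measurable [set w | has (F ^~ w) r].
Proof.
move=> mF; elim: r => [|i r IH] /=.
  by rewrite (_ : [set w | _] = set0)//; apply/seteqP; split.
rewrite (_ : [set w | _] = [set w | F i w] `|` [set w | has (F ^~ w) r]).
  exact: measurableU.
by apply/seteqP; split=> w /= => [/orP[]|[->//|->]]; [left|right|rewrite orbT].
Qed.

Lemma pr_has_le (I : Type) (r : seq I) (F : I -> T -> bool) :
  (forall i, measurable [set w | F i w]) ->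
  prob [set w | has (F ^~ w) r] <= \sum_(i <- r) prob [set w | F i w].
Proof.
move=> mF; elim: r => [|i r IH] /=.
  by rewrite big_nil (_ : [set w | _] = set0) ?/prob ?measure0//; apply/seteqP; split.
rewrite (_ : [set w | _] = [set w | F i w] `|` [set w | has (F ^~ w) r]); last first.
  by apply/seteqP; split=> w /= => [/orP[]|[->//|->]]; [left|right|rewrite orbT].
rewrite big_cons; apply: le_trans (prU_le _ _) _ => //; first exact: measurable_has.
by rewrite lerD2l.
Qed.

Lemma pr_first_entrance (a : nat -> T -> bool) L :
  (forall j, measurable [set w | a j w]) ->
  prob [set w | has (a ^~ w) (iota 0 L.+1)] <=
  prob [set w | a 0%N w] + \sum_(j < L) prob [set w | ~~ a j w && a j.+1 w].
Proof.
move=> ma.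
have mE j : measurable [set w | ~~ a j w && a j.+1 w].
  rewrite (_ : [set w | _] = ~` [set w | a j w] `&` [set w | a j.+1 w]).
    by apply: measurableI => //; exact: measurableC.
  by apply/seteqP; split=> w /= => [/andP[/negP]|[/negP ->]].
have mh n : measurable [set w | has (a ^~ w) (iota 0 n)] := measurable_has _ ma.
elim: L => [|L IH].
  rewrite big_ord0 addr0 /= (_ : [set w | _] = [set w | a 0%N w])//.
  by apply/seteqP; split=> w /=; rewrite orbF.
rewrite big_ord_recr addrA; apply: le_trans (lerD IH (lexx _)).
apply: le_trans (prU_le (mh L.+1) (mE L)).
apply: pr_le; [exact: mh | by apply: measurableU; [exact: mh | exact: mE] | ].
move=> w; rewrite /mkset -[L.+2]addn1 iotaD has_cat add0n [has _ (iota _ 1)]/= orbF.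
case: (boolP (has _ _)) => [hL _|hL /= aL]; first by left.
right; rewrite aL andbT; apply: contra hL => aL'.
by apply/hasP; exists L => //; rewrite mem_iota add0n ltnSn.
Qed.

Section FiniteValued.
Variables (Z : finType) (xi : T -> Z).
Hypothesis mxi : forall z, measurable [set w | xi w = z].

Lemma measurable_finvalued (Q : pred Z) : measurable [set w | Q (xi w)].
Proof.
rewrite (_ : [set w | _] = [set w | has (fun z => xi w == z) (enum Q)]).
  apply: (@measurable_has _ _ (fun z w => xi w == z)) => z.
  by rewrite (_ : [set w | _] = [set w | xi w = z])//; apply/seteqP; split=> w /= /eqP.
apply/seteqP; split=> w /=.
  by move=> Qw; apply/hasP; exists (xi w) => //; rewrite mem_enum.
by move=> /hasP[z]; rewrite mem_enum => Qz /eqP ->.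
Qed.

Lemma pr_finvalued B (Q : pred Z) : measurable B ->
  prob (B `&` [set w | Q (xi w)]) = \sum_(z | Q z) prob (B `&` [set w | xi w = z]).
Proof.
move=> mB.
suff H (r : seq Z) : uniq r ->
    prob (B `&` [set w | xi w \in r]) = \sum_(z <- r) prob (B `&` [set w | xi w = z]).
  rewrite -big_filter -H; last by rewrite filter_uniq ?index_enum_uniq.
  congr (prob (_ `&` _)); apply/seteqP; split=> w /=; rewrite mem_filter mem_index_enum andbT//.
elim: r => [_|z r IH /= /andP[zr ur]].
  rewrite big_nil (_ : _ `&` _ = set0) ?/prob ?measure0//.
  by apply/seteqP; split=> w // [].
rewrite big_cons -IH// -prU.
- congr prob; apply/seteqP; split=> w /=; rewrite inE.
    by move=> [Bw /orP[/eqP|]]; [left|right].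
  by move=> [[Bw ->]|[Bw ->]]; rewrite ?eqxx ?orbT.
- exact: measurableI.
- by apply: measurableI => //; exact: measurable_finvalued.
- by apply/seteqP; split=> w //= [[_ ->] [_]]; rewrite (negbTE zr).
Qed.

End FiniteValued.

Section Count.
Variables (L : nat) (F : 'I_L -> T -> bool).
Hypothesis mF : forall j, measurable [set w | F j w].

Let count w : R := (\sum_(j < L) F j w)%:R.

Let countE : EFin \o count =
  (fun w => \sum_(j < L) (\1_[set w | F j w] w)%:E)%E.
Proof.
apply/funext => w; rewrite sumEFin; congr (_%:E); rewrite /count natr_sum.
apply: eq_bigr => j _; rewrite indicE; congr (nat_of_bool _)%:R.
by apply/idP/idP => [h|/set_mem//]; exact/mem_set.
Qed.

Lemma measurable_event_count : measurable_fun setT (EFin \o count).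
Proof.
rewrite countE; apply: emeasurable_sum => j.
by apply/measurable_EFinP; exact: measurable_indic.
Qed.

Lemma integral_event_count : (\int[P]_w (count w)%:E)%E = (\sum_j prob [set w | F j w])%:E.
Proof.
under eq_integral do rewrite [(count _)%:E](congr1 (fun f => f _) countE).
rewrite ge0_integral_sum//=.
  rewrite -sumEFin; apply: eq_bigr => j _.
  by rewrite integral_indic// setIT; exact: prE.
by move=> j; apply/measurable_EFinP; exact: measurable_indic.
Qed.

Lemma markov_event_count M : 0 < M ->
  measurable [set w | M < count w] /\
  prob [set w | M < count w] <= (\sum_j prob [set w | F j w]) / M.
Proof.
move=> M0.
have mc : measurable_fun setT count by apply/measurable_EFinP/measurable_event_count.
have mA : measurable [set w | M < count w].
  rewrite (_ : [set w | _] = setT `&` count @^-1` `]M, +oo[).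
    exact: mc.
  by apply/seteqP; split=> w /=; rewrite in_itv /= andbT// => -[].
split=> //; rewrite ler_pdivlMr// mulrC -lee_fin EFinM -prE// -integral_event_count.
have /= := le_integral_abse P measurableT measurable_event_count M0.
under eq_integral do rewrite ger0_norm ?ler0n//.
apply: le_trans; rewrite lee_pmul2l// setTI; apply: le_measure => /=.
- exact/mem_set.
- apply/mem_set; rewrite (_ : [set x | _] = setT `&` count @^-1` `[M, +oo[); first exact: mc.
  by apply/seteqP; split=> w /=; rewrite in_itv /= andbT lee_fin ger0_norm ?ler0n// => -[].
- by move=> w /= Mw; rewrite lee_fin ger0_norm ?ler0n// ltW.
Qed.

End Count.
End Prob.

(** * Two-time laws on the cube *)

Section Cube.
Context (R : realType) d (T : measurableType d) (P : probability T R).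
Variables (m : nat) (X : R -> T -> {ffun 'I_m -> bool}).
Hypothesis cX : cube_dynamics P 2^-1 X.
Local Notation pr := (prob P).

Lemma sigma_process_pair (Y : R -> T -> bool) s t (D : bool -> bool -> bool) :
  0 <= s -> 0 <= t -> sigma_process Y [set w | D (Y s w) (Y t w)].
Proof.
move=> s0 t0; rewrite /sigma_process; set G := [set A | _].
have mG u B : 0 <= u -> (@measurable _ (g_sigma_algebraType G)) (Y u @^-1` B).
  by move=> u0; apply: sub_sigma_algebra; exists u; split=> //; exists B.
rewrite (_ : [set w | _] =
  (Y s @^-1` [set true] `&` Y t @^-1` [set y | D true y]) `|`
  (Y s @^-1` [set false] `&` Y t @^-1` [set y | D false y])).
  by apply: (@measurableU _ (g_sigma_algebraType G));
    apply: (@measurableI _ (g_sigma_algebraType G)); apply: mG.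
apply/seteqP; split=> w /=; last by case=> -[->].
by case: (Y s w); [left|right].
Qed.

Lemma cube_coord_measurable s i b : 0 <= s -> measurable [set w | X s w i = b].
Proof.
move=> s0; have [/(_ i)[mY _ _ _] _] := cX.
by have := mY s s0 measurableT [set b]; rewrite setTI; apply.
Qed.

Lemma cube_value_measurable s x : 0 <= s -> measurable [set w | X s w = x].
Proof.
move=> s0; rewrite (_ : [set w | _] = \bigcap_(i in [set: 'I_m]) [set w | X s w i = x i]).
  by apply: fin_bigcap_measurable => // i _; exact: cube_coord_measurable.
by apply/seteqP; split=> w /=; [move=> <- | move=> H; apply/ffunP => i; exact: H].
Qed.

Lemma cube_pair_measurable s t (Q : {ffun 'I_m -> bool} -> {ffun 'I_m -> bool} -> bool) :
  0 <= s -> 0 <= t -> measurable [set w | Q (X s w) (X t w)].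
Proof.
move=> s0 t0.
apply: (@measurable_finvalued _ _ _ (fun w => (X s w, X t w)) _ (fun z => Q z.1 z.2)).
case=> x y; rewrite (_ : [set w | _] = [set w | X s w = x] `&` [set w | X t w = y]).
  by apply: measurableI; exact: cube_value_measurable.
by apply/seteqP; split=> w /=; [case=> -> -> | case=> -> ->].
Qed.

Lemma pr_cube_forall s t (D : 'I_m -> bool -> bool -> bool) : 0 <= s -> 0 <= t ->
  pr [set w | [forall i, D i (X s w i) (X t w i)]] =
  \prod_i pr [set w | D i (X s w i) (X t w i)].
Proof.
move=> s0 t0; have [_ indep] := cX.
have := indep (fun i => [set w | D i (X s w i) (X t w i)]) _.
rewrite (_ : \bigcap_(i in _) _ = [set w | [forall i, D i (X s w i) (X t w i)]]); last first.
  apply/seteqP; split=> w /= H; first by apply/forallP => i; exact: H.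
  by move=> i _ /=; exact: (forallP H).
move=> E; apply: EFin_inj; rewrite -prE; last first.
  exact: (@cube_pair_measurable _ _ (fun x y => [forall i, D i (x i) (y i)])).
rewrite {}E; last by move=> i; exact: (@sigma_process_pair (fun t w => X t w i)).
rewrite (big_morph EFin EFinM erefl); apply: eq_bigr => i _; apply: prE.
exact: (@cube_pair_measurable _ _ (fun x y => D i (x i) (y i))).
Qed.

(* Each coordinate has its own flip function [q i] because the transition
   function in [stationary_chain] is only known to exist. *)
Lemma cube_flips : exists q : 'I_m -> R -> R,
  [/\ forall i h, 0 < h ->
        [/\ 0 <= q i h, q i h <= h, q i h <= 2^-1 & 1 - 2 * q i h <= (1 + h / 2)^-1],
      forall i s h (D : bool -> bool -> bool), 0 <= s -> 0 < h ->
        pr [set w | D (X s w i) (X (s + h) w i)] =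
        2^-1 * (((D true true)%:R + (D false false)%:R) * (1 - q i h) +
                ((D true false)%:R + (D false true)%:R) * q i h)
    & forall i s b, 0 <= s -> pr [set w | X s w i = b] = 2^-1].
Proof.
have [chain _] := cX.
have /choice[q qP] : forall i : 'I_m, exists q : R -> R,
    [/\ forall h, 0 < h ->
          [/\ 0 <= q h, q h <= h, q h <= 2^-1 & 1 - 2 * q h <= (1 + h / 2)^-1],
        forall s h x y, 0 <= s -> 0 < h ->
          P [set w | X s w i = x /\ X (s + h) w i = y] =
            (2^-1 * (if x == y then 1 - q h else q h))%:E
      & forall s x, 0 <= s -> P [set w | X s w i = x] = (2^-1)%:E].
  by move=> i; exact: (chain_pair_law (chain i)).
exists q; split=> [i|i s h D s0 h0|i s b s0]; first by case: (qP i).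
  have [_ law _] := qP i.
  have sh0 : 0 <= s + h by rewrite addr_ge0// ltW.
  have mpair x y : measurable [set w | X s w i = x /\ X (s + h) w i = y].
    by apply: measurableI; exact: cube_coord_measurable.
  have := @pr_finvalued _ _ _ P _ (fun w => (X s w i, X (s + h) w i)) _ setT
    (fun z => D z.1 z.2) measurableT.
  rewrite setTI => -> => [|[x y]]; last first.
    by rewrite (_ : [set w | _] = [set w | X s w i = x /\ X (s + h) w i = y])//;
      apply/seteqP; split=> w /=; [case=> -> -> | case=> -> ->].
  have E z : pr (setT `&` [set w | (X s w i, X (s + h) w i) = z]) =
      2^-1 * (if z.1 == z.2 then 1 - q i h else q i h).
    rewrite setTI (_ : [set w | _] = [set w | X s w i = z.1 /\ X (s + h) w i = z.2]).
      by rewrite /prob law.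
    by case: z => x y; apply/seteqP; split=> w /=; [case=> -> -> | case=> -> ->].
  rewrite big_mkcond /= (eq_bigr (fun z => (D z.1 z.2)%:R *
    (2^-1 * (if z.1 == z.2 then 1 - q i h else q i h)))); last first.
    by move=> z _; case: (D _ _); rewrite ?E ?mul1r ?mul0r.
  rewrite -(pair_bigA _ (fun x y => (D x y)%:R * (2^-1 * (if x == y then 1 - q i h else q i h)))).
  by rewrite /= !big_bool /=; ring.
by have [_ _ H] := qP i; rewrite /prob H.
Qed.

Variable q : 'I_m -> R -> R.
Hypothesis q_bounds : forall i (h : R), 0 < h ->
  [/\ 0 <= q i h, q i h <= h, q i h <= 2^-1 & 1 - 2 * q i h <= (1 + h / 2)^-1].
Hypothesis q_law : forall i (s h : R) (D : bool -> bool -> bool), 0 <= s -> 0 < h ->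
  pr [set w | D (X s w i) (X (s + h) w i)] =
  2^-1 * (((D true true)%:R + (D false false)%:R) * (1 - q i h) +
          ((D true false)%:R + (D false true)%:R) * q i h).
Hypothesis X_law : forall i (s : R) b, 0 <= s -> pr [set w | X s w i = b] = 2^-1.

Lemma pr_coord_flip i s h : 0 <= s -> 0 < h ->
  pr [set w | X s w i != X (s + h) w i] <= h.
Proof.
move=> s0 h0; rewrite (q_law i (fun x y => x != y))//=.
by have [_ qh _ _] := q_bounds i h0; lra.
Qed.

Variable S : {set 'I_m}.

Definition all_ones (x : {ffun 'I_m -> bool}) : bool := [forall i in S, x i].

Definition parity (x : {ffun 'I_m -> bool}) : bool := \big[addb/false]_i x i.

Lemma pr_all_ones s : 0 <= s -> pr [set w | all_ones (X s w)] = 2^-1 ^+ #|S|.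
Proof.
move=> s0; rewrite -prodr_const big_mkcond /=.
rewrite (@pr_cube_forall s s (fun i x _ => (i \in S) ==> x))//.
apply: eq_bigr => i _; case: (i \in S) => /=.
  by rewrite -(X_law i true s0).
by rewrite -(pr_setT P); congr pr; apply/seteqP; split.
Qed.

Lemma pr_all_ones2 s h : 0 <= s -> 0 < h ->
  pr [set w | all_ones (X s w) && all_ones (X (s + h) w)] =
  \prod_(i in S) (2^-1 * (1 - q i h)).
Proof.
move=> s0 h0; have sh0 : 0 <= s + h by rewrite addr_ge0// ltW.
transitivity (pr [set w | [forall i, (i \in S) ==> X s w i && X (s + h) w i]]).
  congr pr; apply/seteqP; split=> w /=.
    move=> /andP[/forall_inP H1 /forall_inP H2]; apply/forall_inP => i iS.
    by rewrite H1// H2.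
  by move=> /forall_inP H; apply/andP; split; apply/forall_inP => i /H/andP[].
rewrite (@pr_cube_forall s (s + h) (fun i x y => (i \in S) ==> x && y))// [RHS]big_mkcond /=.
apply: eq_bigr => i _; rewrite (q_law i (fun x y => (i \in S) ==> x && y))//.
by case: (i \in S) => /=; lra.
Qed.

Lemma pr_enter_all_ones s h : 0 <= s -> 0 < h <= 1 ->
  pr [set w | ~~ all_ones (X s w) && all_ones (X (s + h) w)] <=
  2^-1 ^+ #|S| * (#|S|%:R * h).
Proof.
move=> s0 /andP[h0 h1]; have sh0 : 0 <= s + h by rewrite addr_ge0// ltW.
have E : pr [set w | all_ones (X (s + h) w)] =
    pr [set w | ~~ all_ones (X s w) && all_ones (X (s + h) w)] +
    pr [set w | all_ones (X s w) && all_ones (X (s + h) w)].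
  rewrite -prU.
  - congr pr; apply/seteqP; split=> w /=; last by case=> /andP[].
    by move=> ->; case: all_ones; [right|left].
  - exact: (@cube_pair_measurable _ _ (fun x y => ~~ all_ones x && all_ones y)).
  - exact: (@cube_pair_measurable _ _ (fun x y => all_ones x && all_ones y)).
  - by apply/seteqP; split=> w //= [/andP[/negP n _] /andP[/n]].
move: E; rewrite pr_all_ones// pr_all_ones2//.
suff : 2^-1 ^+ #|S| * (1 - #|S|%:R * h) <= \prod_(i in S) (2^-1 * (1 - q i h)) by lra.
have [h1' b] : 0 <= 1 - h /\ -1 <= - h by lra.
have B := bernoulli_ineq #|S| b.
apply: (@le_trans _ _ (\prod_(i in S) (2^-1 * (1 - h)))); last first.
  apply: ler_prod => i _; have [_ qh _ _] := q_bounds i h0.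
  by apply/andP; split; lra.
rewrite prodr_const exprMn ler_wpM2l// ?exprn_ge0//.
by move: B; rewrite mulrN.
Qed.

(* Writing [odd] as [(1 - (-1)^parity) / 2] makes the sum over all flip
   patterns factor over the coordinates. *)
Lemma pr_all_ones2_parity s h : 0 <= s -> 0 < h ->
  pr [set w | [&& all_ones (X s w), all_ones (X (s + h) w) &
                  parity (X s w) != parity (X (s + h) w)]] =
  2^-1 * (\prod_(i in S) (2^-1 * (1 - q i h))) *
    (1 - \prod_(i in ~: S) (1 - 2 * q i h)).
Proof.
move=> s0 h0; have sh0 : 0 <= s + h by rewrite addr_ge0// ltW.
pose B := [set w | all_ones (X s w) && all_ones (X (s + h) w)].
have mB : measurable B.
  exact: (@cube_pair_measurable _ _ (fun x y => all_ones x && all_ones y)).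
pose flip (x y : {ffun 'I_m -> bool}) := [ffun i => x i (+) y i].
pose xi w := flip (X s w) (X (s + h) w).
have mxi z : measurable [set w | xi w = z].
  rewrite (_ : [set w | _] = [set w | flip (X s w) (X (s + h) w) == z]).
    exact: (@cube_pair_measurable _ _ (fun x y => flip x y == z)).
  by apply/seteqP; split=> w /= /eqP.
rewrite (_ : [set w | _] = B `&` [set w | parity (xi w)]); last first.
  have pE w : parity (xi w) = (parity (X s w) != parity (X (s + h) w)).
    by rewrite negb_eqb /parity -big_split; apply: eq_bigr => i _; rewrite ffunE.
  by apply/seteqP; split=> w /=; rewrite /B /= pE; [case/and3P=> -> -> | case=> /andP[-> ->]].
rewrite (pr_finvalued P mxi _ mB).
pose W i b := pr [set w | ((i \in S) ==> X s w i && X (s + h) w i) &&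
                          (X s w i (+) X (s + h) w i == b)].
have WE i b : W i b = if i \in S then if b then 0 else 2^-1 * (1 - q i h)
                      else if b then q i h else 1 - q i h.
  rewrite /W (q_law i (fun x y => ((i \in S) ==> x && y) && (x (+) y == b)))//.
  by case: (i \in S); case: b => /=; lra.
have BE z : pr (B `&` [set w | xi w = z]) = \prod_i W i (z i).
  rewrite -(@pr_cube_forall s (s + h)
    (fun i x y => ((i \in S) ==> x && y) && (x (+) y == z i)))//.
  congr pr; apply/seteqP; split=> w /=.
    move=> [/andP[/forall_inP H1 /forall_inP H2] <-]; apply/forallP => i.
    by rewrite ffunE eqxx andbT; apply/implyP => iS; rewrite H1// H2.
  move=> /forallP H; split; last by apply/ffunP => i; rewrite ffunE; have /andP[_ /eqP] := H i.
  by apply/andP; split; apply/forall_inP => i iS; have := H i; rewrite iS => /andP[/andP[]].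
rewrite (eq_bigr _ (fun z _ => BE z)).
rewrite big_mkcond /= (eq_bigr (fun z : {ffun 'I_m -> bool} =>
  2^-1 * (\prod_i W i (z i) - \prod_i ((-1) ^+ z i * W i (z i))))); last first.
  move=> z _; rewrite big_split /=.
  have -> : \prod_i (-1 : R) ^+ z i = (-1) ^+ parity z.
    by rewrite /parity (big_morph (fun b : bool => (-1) ^+ b) (@signr_addb R) erefl).
  by case: (parity z) => /=; lra.
rewrite -mulr_sumr sumrB -!(bigA_distr_bigA (fun i b => W i b)).
rewrite -(bigA_distr_bigA (fun i (b : bool) => (-1) ^+ b * W i b)) -mulrA; congr (_ * _).
rewrite mulrBr mulr1; congr (_ - _).
  rewrite [RHS]big_mkcond; apply: eq_bigr => i _.
  by rewrite big_bool !WE; case: (i \in S) => /=; lra.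
rewrite (bigID (mem S)) /=; congr (_ * _).
  by apply: eq_bigr => i iS; rewrite big_bool /= !WE iS /=; lra.
apply: eq_big => i; first by rewrite !inE.
by move=> /negbTE iS; rewrite big_bool /= !WE iS /=; lra.
Qed.

Lemma pr_all_ones2_parity_ge s h : 0 <= s -> 0 < h <= 1 -> 1 <= #|~: S|%:R * h ->
  4^-1 ^+ #|S| / 6 <=
  pr [set w | [&& all_ones (X s w), all_ones (X (s + h) w) &
                  parity (X s w) != parity (X (s + h) w)]].
Proof.
move=> s0 /andP[h0 h1] Sh; rewrite pr_all_ones2_parity//.
have le1 : 4^-1 ^+ #|S| <= \prod_(i in S) (2^-1 * (1 - q i h)).
  rewrite -prodr_const; apply: ler_prod => i _; have [_ _ q2 _] := q_bounds i h0.
  by apply/andP; split; lra.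
have h2 : -1 <= h / 2 by lra.
have le2 : \prod_(i in ~: S) (1 - 2 * q i h) <= 2 / 3.
  apply: (@le_trans _ _ (\prod_(i in ~: S) (1 + h / 2)^-1)).
    apply: ler_prod => i _; have [_ _ q2 q3] := q_bounds i h0.
    by rewrite q3 andbT; lra.
  have := bernoulli_ineq #|~: S| h2.
  have -> : 2 / 3 = (3 / 2)^-1 :> R by lra.
  rewrite prodr_const exprVn => B; rewrite lef_pV2 ?posrE ?exprn_gt0//; lra.
have : 0 <= 4^-1 ^+ #|S| :> R by rewrite exprn_ge0.
by nra.
Qed.

End Cube.

(** * Number of changes *)

Section Changes.
Context (R : realType) d (T : measurableType d) (P : probability T R).
Variables (m : nat) (X : R -> T -> {ffun 'I_m -> bool}).
Hypothesis cX : cube_dynamics P 2^-1 X.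
Local Notation pr := (prob P).
Implicit Types (f : {ffun 'I_m -> bool} -> bool) (L : nat) (M : R).

Definition observed f w (t : R) : bool := f (X t w).

Lemma observed_cadlag f w : cadlag (observed f w).
Proof.
have [chain _] := cX; rewrite /observed; split=> t t0.
  have H : \forall s \near t^'+, forall i, X s w i = X t w i.
    by apply: filter_forall => i; have [_ /(_ w)[rc _] _ _] := chain i; exact: rc.
  by apply: filterS H => s Hs; congr f; apply/ffunP.
have /choice[a aP] : forall i, exists b, \forall s \near t^'-, X s w i = b.
  by move=> i; have [_ /(_ w)[_ lc] _ _] := chain i; exact: lc.
exists (f [ffun i => a i]).
have H : \forall s \near t^'-, forall i, X s w i = a i by apply: filter_forall => i.
by apply: filterS H => s Hs; congr f; apply/ffunP => i; rewrite ffunE.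
Qed.

Lemma grid_time_ge0 L j : 0 <= j%:R / L%:R :> R.
Proof. by rewrite divr_ge0. Qed.

Lemma grid_timeS L j : j.+1%:R / L%:R = j%:R / L%:R + L%:R^-1 :> R.
Proof. by rewrite -natr1 mulrDl mul1r. Qed.

Lemma grid_flip_measurable f L j :
  measurable [set w | observed f w (j%:R / L%:R) != observed f w (j.+1%:R / L%:R)].
Proof.
exact: (@cube_pair_measurable _ _ _ _ _ _ cX _ _ (fun x y => f x != f y)
  (grid_time_ge0 _ _) (grid_time_ge0 _ _)).
Qed.

Lemma markov_grid f L M : 0 < M ->
  measurable [set w | M < (grid_changes (observed f w) L)%:R] /\
  pr [set w | M < (grid_changes (observed f w) L)%:R] <=
  (\sum_(j < L) pr [set w | observed f w (j%:R / L%:R) !=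
                            observed f w (j.+1%:R / L%:R)]) / M.
Proof.
move=> M0; apply: (@markov_event_count _ _ _ P L (fun (j : 'I_L) w =>
  observed f w (j%:R / L%:R) != observed f w (j.+1%:R / L%:R))) => // j.
exact: grid_flip_measurable.
Qed.

Lemma grid_measurable f L M :
  measurable [set w | M < (grid_changes (observed f w) L)%:R].
Proof.
have mc := @measurable_event_count R d T L (fun (j : 'I_L) w =>
  observed f w (j%:R / L%:R) != observed f w (j.+1%:R / L%:R))
  (fun j => grid_flip_measurable f L j).
have := emeasurable_fun_o_infty measurableT mc M%:E.
by rewrite setTI; congr measurable; apply/seteqP; split=> w /=; rewrite lte_fin.
Qed.

(* [P] is unconstrained on nonmeasurable sets, so the event has to be shown
   measurable before its probability can be estimated. *)
Lemma changes_gtE f M : [set w | (M%:E < changes f X w)%E] =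
  \bigcup_K \bigcap_(L in [set L | (K < L)%N])
    [set w | M < (grid_changes (observed f w) L)%:R].
Proof.
apply/seteqP; split=> w /=.
  move=> /(num_changes_gtP M (observed_cadlag f w))[K HK].
  by exists K => // L /= KL; exact/HK/ltnW.
move=> [K _ HK]; apply/(num_changes_gtP M (observed_cadlag f w)).
by exists K.+1 => L; exact: HK.
Qed.

Lemma changes_gt_measurable f M : measurable [set w | (M%:E < changes f X w)%E].
Proof.
rewrite changes_gtE; apply: bigcup_measurable => K _.
by apply: bigcap_measurableType => L _; exact: grid_measurable.
Qed.

Lemma changes_measurable f : measurable_fun setT (changes f X).
Proof.
apply: (measurability _ (ErealGenOInfty.measurableE R)) => //= _ [_ [M ->] <-].
rewrite setTI (_ : _ @^-1` _ = [set w | (M%:E < changes f X w)%E]).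
  exact: changes_gt_measurable.
by apply/seteqP; split=> w /=; rewrite in_itv /= andbT.
Qed.

Lemma pr_changes_gt_le f M b :
  (forall L, (0 < L)%N -> pr [set w | M < (grid_changes (observed f w) L)%:R] <= b) ->
  (P [set w | (M%:E < changes f X w)%E] <= b%:E)%E.
Proof.
move=> Hb; have := changes_gt_measurable f M; rewrite changes_gtE.
set B := fun K => \bigcap_(L in _) _; move=> mU.
have mB K : measurable (B K).
  by apply: bigcap_measurableType => L _; exact: grid_measurable.
have ndB : nondecreasing_seq B.
  move=> K K' KK'; apply/subsetPset => w BK L /= K'L; apply: BK => /=.
  exact: leq_ltn_trans K'L.
have cv := nondecreasing_cvg_mu (mu := P) mB mU ndB.
rewrite -(cvg_lim _ cv)//; apply: lime_le; first exact: (cvgP _ cv).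
apply: nearW => K /=; apply: (@le_trans _ _ (P [set w | M < (grid_changes (observed f w) K.+1)%:R])).
  apply: le_measure => /=; [exact/mem_set/mB | exact/mem_set/grid_measurable | ].
  by move=> w /(_ K.+1 (ltnSn K)).
by rewrite prE ?lee_fin; [exact: Hb | exact: grid_measurable].
Qed.

Lemma integral_changes_ge f L c :
  (forall j, (j < L)%N -> c <= pr [set w | observed f w (j%:R / L%:R) !=
                            observed f w (j.+1%:R / L%:R)]) ->
  ((L%:R * c)%:E <= \int[P]_w changes f X w)%E.
Proof.
move=> Hc.
have mF (j : 'I_L) := grid_flip_measurable f L j.
apply: (@le_trans _ _ (\int[P]_w ((grid_changes (observed f w) L)%:R)%:E)%E).
  have -> := integral_event_count P mF.
  rewrite lee_fin mulr_natl -[X in _ *+ X]card_ord -sumr_const.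
  by apply: ler_sum => j _; exact: Hc.
apply: ge0_le_integral => //.
- exact: (measurable_event_count mF).
- exact: changes_measurable.
- by move=> w _; exact/grid_changes_le/observed_cadlag.
Qed.

Lemma pr_grid_le_dim f L M : (0 < L)%N -> 0 < M ->
  pr [set w | M < (grid_changes (observed f w) L)%:R] <= m%:R / M.
Proof.
move=> L0 M0; have L0' : 0 < L%:R :> R by rewrite ltr0n.
have [q [qb ql Xl]] := cube_flips cX.
have [_ H] := markov_grid f L M0; apply: le_trans H _.
rewrite ler_pM2r ?invr_gt0//.
have -> : m%:R = \sum_(j < L) \sum_(i <- enum 'I_m) L%:R^-1 :> R.
  rewrite sumr_const big_enum sumr_const !card_ord -mulrnA -(mulr_natl _ (_ * _)) natrM.
  by rewrite -mulrA divff ?gt_eqF// mulr1.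
apply: ler_sum => j _.
pose F i w := X (j%:R / L%:R) w i != X (j.+1%:R / L%:R) w i.
have mF i : measurable [set w | F i w].
  exact: (@cube_pair_measurable _ _ _ _ _ _ cX _ _ (fun x y => x i != y i)
    (grid_time_ge0 _ _) (grid_time_ge0 _ _)).
apply: (@le_trans _ _ (pr [set w | has (F ^~ w) (enum 'I_m)])).
  apply: pr_le; [exact: grid_flip_measurable | exact: measurable_has | ].
  move=> w /=; rewrite /observed; apply: contraNT => /hasPn nF.
  apply/eqP; congr f; apply/ffunP => i; apply/eqP.
  by have := nF i; rewrite mem_enum /F negbK; apply.
apply: le_trans (pr_has_le P _ mF) _; apply: ler_sum => i _.
by rewrite /F grid_timeS; apply: (pr_coord_flip qb ql); rewrite ?grid_time_ge0 ?invr_gt0.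
Qed.

Section RareParity.
Variables (S : {set 'I_m}) (i0 : 'I_m).

Definition rare_parity (x : {ffun 'I_m -> bool}) : bool :=
  if all_ones S x then parity x else x i0.

Lemma pr_rare_parity s : 0 <= s ->
  `|pr [set w | rare_parity (X s w) = true] - 2^-1| <= 2^-1 ^+ #|S|.
Proof.
move=> s0; have [q [qb ql Xl]] := cube_flips cX.
have mQ (Q : {ffun 'I_m -> bool} -> bool) : measurable [set w | Q (X s w)].
  exact: (@cube_pair_measurable _ _ _ _ _ _ cX _ _ (fun x _ => Q x) s0 s0).
rewrite -(pr_all_ones cX Xl S s0) -(Xl i0 s true s0) ler_distlC.
have mA := mQ (all_ones S); have mf := mQ rare_parity; have mi := mQ (fun x => x i0).
rewrite lerBlDr; apply/andP; split.
  apply: le_trans (prU_le P mi mA); apply: pr_le => //; first exact: measurableU.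
  by move=> w /=; rewrite /rare_parity; case: ifP; [right|left].
apply: le_trans (prU_le P mf mA); apply: pr_le => //; first exact: measurableU.
by move=> w /=; rewrite /rare_parity; case: ifP; [right|left].
Qed.

Lemma pr_grid_rare_parity_le L M : (0 < L)%N -> 0 < M ->
  pr [set w | M < (grid_changes (observed rare_parity w) L)%:R] <=
  2^-1 ^+ #|S| * (1 + #|S|%:R) + M^-1.
Proof.
move=> L0 M0; have L0' : 0 < L%:R :> R by rewrite ltr0n.
have [q [qb ql Xl]] := cube_flips cX.
pose a j w := all_ones S (X (j%:R / L%:R) w).
have ma j : measurable [set w | a j w].
  exact: (@cube_pair_measurable _ _ _ _ _ _ cX _ _ (fun x _ => all_ones S x)
    (grid_time_ge0 L j) (grid_time_ge0 L j)).
have mh : measurable [set w | has (a ^~ w) (iota 0 L.+1)] := measurable_has _ ma.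
pose g (x : {ffun 'I_m -> bool}) := x i0.
have [mg Mg] := markov_grid g L M0.
apply: (@le_trans _ _ (pr ([set w | has (a ^~ w) (iota 0 L.+1)] `|`
    [set w | M < (grid_changes (observed g w) L)%:R]))).
  apply: pr_le; [exact: grid_measurable | exact: measurableU | ].
  move=> w Mw; case: (boolP (has (a ^~ w) (iota 0 L.+1))) => [|/hasPn na]; first by left.
  right; move: Mw => /=; congr (_ < _%:R); apply: eq_bigr => j _.
  have na' i : (i <= L)%N -> observed rare_parity w (i%:R / L%:R) = observed g w (i%:R / L%:R).
    move=> iL; rewrite /observed /rare_parity.
    by have := na i; rewrite mem_iota add0n ltnS iL => /(_ isT) /negbTE; rewrite /a => ->.
  by rewrite !na'// ltnW.
apply: le_trans (prU_le P mh mg) _; apply: lerD.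
  apply: le_trans (pr_first_entrance P L ma) _.
  rewrite /a (pr_all_ones cX Xl S (grid_time_ge0 L 0)) mulrDr mulr1 lerD2l.
  have -> : 2^-1 ^+ #|S| * #|S|%:R = \sum_(j < L) 2^-1 ^+ #|S| * (#|S|%:R * L%:R^-1) :> R.
    by rewrite sumr_const card_ord -mulr_natl; field; rewrite gt_eqF.
  apply: ler_sum => j _; rewrite grid_timeS.
  apply: (pr_enter_all_ones cX qb ql Xl S (grid_time_ge0 L j)).
  by rewrite invr_gt0 L0' /= invf_le1// ler1n.
apply: le_trans Mg _; rewrite ler_piMl ?invr_ge0 ?(ltW M0)//.
have E1 : 1 = \sum_(j < L) L%:R^-1 :> R.
  by rewrite sumr_const card_ord -(mulr_natl L%:R^-1) divff// gt_eqF.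
rewrite [leRHS]E1; apply: ler_sum => j _; rewrite /observed /g grid_timeS.
by apply: (pr_coord_flip qb ql); rewrite ?grid_time_ge0 ?invr_gt0.
Qed.

Lemma integral_changes_rare_parity_ge L : (0 < L)%N -> (L <= #|~: S|)%N ->
  ((L%:R * (4^-1 ^+ #|S| / 6))%:E <= \int[P]_w changes rare_parity X w)%E.
Proof.
move=> L0 LS; have L0' : 0 < L%:R :> R by rewrite ltr0n.
have [q [qb ql Xl]] := cube_flips cX.
apply: integral_changes_ge => j jL.
have h1 : 0 < (L%:R^-1 : R) <= 1 by rewrite invr_gt0 L0' /= invf_le1// ler1n.
have h2 : 1 <= #|~: S|%:R * L%:R^-1 :> R by rewrite ler_pdivlMr// mul1r ler_nat.
apply: le_trans (pr_all_ones2_parity_ge cX qb ql (grid_time_ge0 L j) h1 h2) _.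
rewrite -grid_timeS; apply: pr_le; last 1 first.
- by move=> w /= /and3P[a1 a2]; rewrite /observed /rare_parity a1 a2.
- exact: (@cube_pair_measurable _ _ _ _ _ _ cX _ _ (fun x y =>
    [&& all_ones S x, all_ones S y & parity x != parity y])
    (grid_time_ge0 _ _) (grid_time_ge0 _ _)).
- exact: grid_flip_measurable.
Qed.

End RareParity.
End Changes.

Theorem proposition1p20 (R : realType) :
  exists (m : nat -> nat) (f : forall n, {ffun 'I_(m n) -> bool} -> bool),
  forall (d : nat -> measure_display) (T : forall n, measurableType (d n))
    (P : forall n, probability (T n) R)
    (X : forall n, R -> T n -> {ffun 'I_(m n) -> bool}),
    (forall n, cube_dynamics (P n) (2^-1) (X n)) ->
    [/\ nondegenerate_sequence f P X,
        (\int[P n]_w changes (f n) (X n) w)%E @[n --> \oo] --> +oo%E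
      & tame_sequence f P X].
Proof.
pose k n := n.+1.*2; pose L n := (8 ^ k n)%N; pose m n := (k n + (L n).+1)%N.
pose S n : {set 'I_(m n)} := [set lshift (L n).+1 i | i : 'I_(k n)].
pose i0 n : 'I_(m n) := rshift (k n) ord0.
have L0 n : (0 < L n)%N by rewrite expn_gt0.
have cS n : #|S n| = k n by rewrite card_imset ?card_ord//; exact: lshift_inj.
have cCS n : (L n <= #|~: S n|)%N.
  by have := cardsC (S n); rewrite cS card_ord => /addnI ->.
have k2 n : (n.+2%:R : R) ^+ 2 <= 2 ^+ k n.
  rewrite /k -muln2 exprM lerXn2r ?nnegrE ?exprn_ge0// -natrX ler_nat.
  exact: ltn_expl.
exists m, (fun n => rare_parity (S n) (i0 n)) => d T P X cX; split.
- exists 4^-1; split=> [|n]; first by rewrite invr_gt0.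
  have := pr_rare_parity (cX n) (S n) (i0 n) (lexx 0).
  have mf : measurable [set w | rare_parity (S n) (i0 n) (X n 0 w) = true].
    exact: (@cube_pair_measurable _ _ _ _ _ _ (cX n) _ _
      (fun x _ => rare_parity (S n) (i0 n) x) (lexx 0) (lexx 0)).
  rewrite (prE _ mf) !lee_fin cS ler_distl.
  have : (2^-1 : R) ^+ k n <= 4^-1.
    rewrite exprVn lef_pV2 ?posrE ?exprn_gt0//.
    apply: le_trans (k2 n); rewrite -natrX ler_nat; exact: (@leq_sqr 2).
  by move=> h /andP[h1 h2]; apply/andP; split; lra.
- apply/cvgeyPge => A; exists (Num.truncn (6 * A)).+1 => // n /= An.
  have E : (L n)%:R * (4^-1 ^+ k n / 6) = 2 ^+ k n / 6 :> R.
    rewrite /L (natrX _ 8 (k n)) mulrA -exprMn.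
    by congr (_ ^+ _ / _); lra.
  have B := integral_changes_rare_parity_ge (cX n) (i0 n) (L0 n) (cCS n).
  rewrite cS E in B.
  apply: le_trans B.
  rewrite lee_fin ler_pdivlMr// mulrC; apply: le_trans (ltW (truncnS_gt _)) _.
  apply: (@le_trans _ _ n%:R); first by rewrite ler_nat.
  apply: le_trans (k2 n); rewrite -(natrX _ n.+2) ler_nat.
  by rewrite (leq_trans _ (leq_pmulr _ _))// ltnW.
- move=> eps eps0.
  pose N := (Num.truncn (4 / eps)).+1.
  pose D := (\sum_(n < N) m n)%N.
  pose M : R := 2 * (1 + D%:R) / eps.
  have M0 : 0 < M by rewrite divr_gt0// mulr_gt0// ltr_pwDl.
  exists M => n; apply: pr_changes_gt_le => // l l0.
  have [nN|Nn] := ltnP n N.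
    apply: le_trans (pr_grid_le_dim (cX n) _ l0 M0) _.
    have mD : (m n <= D)%N by rewrite /D (bigD1 (Ordinal nN))//= leq_addr.
    rewrite ler_pdivrMr// /M mulrCA divff ?gt_eqF// mulr1.
    by move: mD; rewrite -(ler_nat R); have : 0 <= D%:R :> R := ler0n R D; lra.
  apply: le_trans (pr_grid_rare_parity_le (cX n) (S n) (i0 n) l0 M0) _.
  rewrite cS; have -> : eps = eps / 2 + eps / 2 by lra.
  apply: lerD.
    rewrite exprVn mulrC ler_pdivrMr ?exprn_gt0//.
    have kn : 1 + (k n)%:R <= 2 * n.+2%:R :> R by rewrite -natrM -[1]/(1%:R) -natrD ler_nat /k; lia.
    apply: le_trans kn _.
    have e2 : 4 <= eps * n.+2%:R.
      rewrite mulrC -ler_pdivrMr//; apply: le_trans (ltW (truncnS_gt _)) _.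
      by rewrite ler_nat ltnW// ltnW.
    apply: le_trans (ler_wpM2l _ (k2 n)); last lra.
    by have : 0 <= n.+2%:R :> R := ler0n R n.+2; nra.
  rewrite /M invf_div ler_pdivrMr ?mulr_gt0 ?ltr_pwDl//.
  by have : 0 <= D%:R :> R := ler0n R D; nra.
Qed.
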